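(* Let $G$ be a virtually nilpotent group and let $A\subseteq G$ be finite, non-empty, and symmetric (i.e. $A^{-1}=A$). Then, for every $r\in\mathbb N$, there exist $l=l(A,r)\in\mathbb N$ and $h_0\in\mathbb N$ such that, for every integer $h\ge h_0$, there is a set $X_h\subseteq\langle A\rangle$ with \[ |X_h|\le l\quad\text{and}\quad A^{rh}\subseteq X_hA^h . \] Thus $A$ is an asymptotic approximate group.
   Context: $\mathbb N=\{1,2,3,\dots\}$. For subsets $E,F$ of a group $G$: $EF=\{ef:e\in E,f\in F\}$, $E^{-1}=\{e^{-1}:e\in E\}$, $E^0=\{e\}$, and for $h\ge1$, $E^h$ is the set of products of exactly $h$ elements of $E$. $\langle E\rangle$ is the subgroup generated by $E$. A group is virtually nilpotent if it contains a nilpotent subgroup of finite index (it need not be finitely generated). For $r,l\in\mathbb N$, a non-empty set $A\subseteq G$ is an asymptotic $(r,l)$-approximate group if there is $h_0\in\mathbb N$ such that for every integer $h\ge h_0$ there is a set $X_h\subseteq G$ with $|X_h|\le l$ and $A^{rh}\subseteq X_hA^h$. $A$ is an asymptotic approximate group if for every $r\in\mathbb N$ there exists $l=l(A,r)\in\mathbb N$ such that $A$ is an asymptotic $(r,l)$-approximate group. *)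

(* Defs.v *)
From mathcomp Require Import all_boot.
From mathcomp Require Import boolp classical_sets functions cardinality.

Set Implicit Arguments.
Unset Strict Implicit.
Unset Printing Implicit Defensive.

Local Open Scope classical_set_scope.
Local Open Scope card_scope.
Local Open Scope group_scope.

(* Groups are possibly infinite: G : groupType, with subsets in [set G]. *)

Definition mul_set (G : groupType) (E F : set G) : set G :=
  [set x * y | x in E & y in F].

Definition inv_set (G : groupType) (E : set G) : set G :=
  [set x^-1 | x in E].

(* For h = 0 the only value is the empty product, so exp_set E 0 = [set 1]
   even when E is empty. *)
Definition exp_set (G : groupType) (E : set G) (h : nat) : set G :=
  [set \prod_(i < h) f i | f in [set f : 'I_h -> G | forall i, E (f i)]].

Definition subgroup (G : groupType) (H : set G) : Prop := group_closed (mem H).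

Definition gen_set (G : groupType) (E : set G) : set G :=
  smallest (@subgroup G) E.

Definition commg_subgroup (G : groupType) (H K : set G) : set G :=
  gen_set [set [~ x, y] | x in H & y in K].

(* Indexed from 0: [lower_central H n] is usually written gamma_(n+1)(H). *)
Fixpoint lower_central (G : groupType) (H : set G) (n : nat) : set G :=
  if n is m.+1 then commg_subgroup (lower_central H m) H else H.

(* Meant for a subgroup H; the series computed inside G is that of H. *)
Definition nilpotent_set (G : groupType) (H : set G) : Prop :=
  exists n, lower_central H n = [set 1].

Definition left_coset (G : groupType) (H : set G) (x : G) : set G :=
  [set x * y | y in H].

Definition finite_index (G : groupType) (H : set G) : Prop :=
  finite_set (range (left_coset H)).

Definition virtually_nilpotent (G : groupType) : Prop :=
  exists H : set G, [/\ subgroup H, nilpotent_set H & finite_index H].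

Definition asymptotic_rl_approximate_group (G : groupType) (r l : nat)
    (A : set G) : Prop :=
  A !=set0 /\
  exists h0 : nat, (0 < h0)%N /\
    forall h : nat, (h0 <= h)%N ->
      exists X : set G,
        X #<= `I_l /\ exp_set A (r * h)%N `<=` mul_set X (exp_set A h).

Definition asymptotic_approximate_group (G : groupType) (A : set G) : Prop :=
  forall r : nat, (0 < r)%N ->
    exists l : nat, (0 < l)%N /\ asymptotic_rl_approximate_group r l A.

(* Main.v *)
(* By Schreier's argument and a parity adjustment it suffices to treat a finite
   symmetric set S in a nilpotent group of class c, and to cover the ball of
   radius K n by boundedly many translates of the ball of radius M n, where M
   does not depend on K and n runs over powers of 2.

   Give weight w to a w-fold iterated commutator of elements of S, and give a
   word in such commutators the norm obtained by summing n^(-w) over its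
   letters.  A word of length K n in S has norm K.  Conjugating a word p by a
   word q costs a factor at most exp(norm q), so collecting all occurrences of
   a letter to the front keeps norms bounded independently of n.  By downward
   induction on the weight, words of bounded norm lie in balls of radius O(n):
   a letter x of weight w satisfies x^(n^w) in B(O(n)) up to heavier letters,
   by taking iterated commutators of the s^n, and other exponents follow by
   writing them in base 2^w.  The covering follows by the same induction: in
   x^a v with v free of x, divide a by n^w; the quotient takes boundedly many
   values, and the remainder x^r is moved to the right of v, into the ball. *)

Require Import Defs.
From mathcomp Require Import all_boot order ssralg ssrnum archimedean.
From mathcomp Require Import boolp classical_sets functions cardinality.
From mathcomp Require Import reals Rstruct sequences exp.

Set Implicit Arguments.
Unset Strict Implicit.
Unset Printing Implicit Defensive.

Import Order.TTheory GRing.Theory Num.Theory.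
Local Open Scope classical_set_scope.
Local Open Scope card_scope.
Local Open Scope group_scope.

(** * Commutator identities *)

Section CommutatorIdentities.
Variable G : groupType.
Implicit Types x y z : G.

Lemma commMgJ x y z : [~ x * y, z] = [~ x, z] ^ y * [~ y, z].
Proof. by rewrite !commgEr conjgM mulgA -conjMg mulgK. Qed.

Lemma commgMJ x y z : [~ x, y * z] = [~ x, z] * [~ x, y] ^ z.
Proof. by rewrite !commgEl conjgM -mulgA -conjMg mulVKg. Qed.

Lemma mulg_commg x y : x * [~ x, y] = x ^ y.
Proof. by rewrite commgEl mulVKg. Qed.

Lemma Hall_Witt_identity x y z :
  [~ x, y^-1, z] ^ y * [~ y, z^-1, x] ^ z * [~ z, x^-1, y] ^ x = 1.
Proof.
by rewrite /commg /conjg !invgM !invgK !mulgA; rewrite ?(mulgVK, mulgK, mulVg).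
Qed.

End CommutatorIdentities.

(** * Conjugates and commutators of weighted words *)

Section Words.
Variable G : groupType.
Implicit Types (x y z c : G * nat) (p q v : seq (G * nat)).

(* A letter [(g, w)] is a group element [g] together with a weight [w]. *)
Definition ev p : G := \prod_(x <- p) x.1.

Lemma ev_nil : ev [::] = 1. Proof. exact: big_nil. Qed.

Lemma ev_cons x p : ev (x :: p) = x.1 * ev p.
Proof. exact: big_cons. Qed.

Lemma ev_cat p q : ev (p ++ q) = ev p * ev q.
Proof. exact: big_cat. Qed.

Lemma ev_nseq n x : ev (nseq n x) = x.1 ^+ n.
Proof. by elim: n => [|n IH]; rewrite ?ev_nil //= ev_cons IH expgS. Qed.

Definition lcomm x y : G * nat := ([~ x.1, y.1], (x.2 + y.2)%N).
Definition linv x : G * nat := (x.1^-1, x.2).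

(* [x ^ y = x * [~ x, y]]: conjugating a word inserts heavier letters. *)
Definition conj1w p y := flatten [seq [:: x; lcomm x y] | x <- p].
Definition conjw p q := foldl conj1w p q.

Lemma ev_conj1w p y : ev (conj1w p y) = ev p ^ y.1.
Proof.
elim: p => [|x p IH]; first by rewrite /conj1w /= ev_nil conj1g.
by rewrite /conj1w /= !ev_cons -/(conj1w p y) IH conjMg mulgA mulg_commg.
Qed.

Lemma ev_conjw p q : ev (conjw p q) = ev p ^ ev q.
Proof.
elim: q p => [|y q IH] p /=; first by rewrite ev_nil conjg1.
by rewrite IH ev_conj1w ev_cons conjgM.
Qed.

(** The recursions follow the product rules for commutators, so that a commutator of two words is an
    explicit word whose letters and norm can be controlled. *)
Fixpoint comm1w x q :=
  if q is y :: q' then comm1w x q' ++ conjw [:: lcomm x y] q' else [::].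
Fixpoint commw p q :=
  if p is x :: p' then conjw (comm1w x q) p' ++ commw p' q else [::].

Lemma ev_comm1w x q : ev (comm1w x q) = [~ x.1, ev q].
Proof.
elim: q => [|y q IH] /=; first by rewrite ev_nil commg1.
by rewrite ev_cat IH ev_conjw !ev_cons ev_nil mulg1 commgMJ.
Qed.

Lemma ev_commw p q : ev (commw p q) = [~ ev p, ev q].
Proof.
elim: p => [|x p IH] /=; first by rewrite ev_nil comm1g.
by rewrite ev_cat IH ev_conjw ev_comm1w ev_cons commMgJ.
Qed.

End Words.

(** * The norm of a weighted word *)

Section WordNorm.
Variables (G : groupType) (R : realType) (t : R).
Hypothesis t_ge0 : (0 <= t)%R.
Implicit Types (x y z c : G * nat) (p q v : seq (G * nat)).

Definition wnorm p : R := (\sum_(x <- p) t ^+ x.2)%R.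

Lemma wnorm_nil : wnorm [::] = 0%R. Proof. exact: big_nil. Qed.

Lemma wnorm_cons x p : wnorm (x :: p) = (t ^+ x.2 + wnorm p)%R.
Proof. exact: big_cons. Qed.

Lemma wnorm_cat p q : wnorm (p ++ q) = (wnorm p + wnorm q)%R.
Proof. exact: big_cat. Qed.

Lemma wnorm_ge0 p : (0 <= wnorm p)%R.
Proof. by apply: sumr_ge0 => x _; exact: exprn_ge0. Qed.

Lemma wnorm_nseq n x : wnorm (nseq n x) = (t ^+ x.2 *+ n)%R.
Proof.
by elim: n => [|n IH]; rewrite ?wnorm_nil ?mulr0n //= wnorm_cons IH mulrS.
Qed.

Lemma wnorm_count c p : (t ^+ c.2 *+ count_mem c p <= wnorm p)%R.
Proof.
elim: p => [|x p IH] /=; first by rewrite wnorm_nil.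
rewrite wnorm_cons mulrnDr lerD //; case: eqP => [->|_] //.
exact: exprn_ge0.
Qed.

Lemma wnorm_filter (P : pred (G * nat)) p :
  (wnorm (filter P p) <= wnorm p)%R.
Proof.
elim: p => [|x p IH] //=; case: ifP => _; rewrite !wnorm_cons ?lerD2l //.
by rewrite (le_trans IH) // lerDr exprn_ge0.
Qed.

Lemma wnorm_conj1w p y : wnorm (conj1w p y) = (wnorm p * (1 + t ^+ y.2))%R.
Proof.
elim: p => [|x p IH]; first by rewrite /conj1w /= wnorm_nil mul0r.
rewrite /conj1w /= !wnorm_cons -/(conj1w p y) IH /= mulrDl addrA; congr (_ + _)%R.
by rewrite mulrDr mulr1 exprD.
Qed.

(** Each letter [y] of [q] multiplies the norm by exactly [1 + t ^+ y.2]; the inequality 1 + u <=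
    exp u turns the product of these factors into a bound that ignores the length of [q]. *)
Lemma wnorm_conjw p q : (wnorm (conjw p q) <= wnorm p * expR (wnorm q))%R.
Proof.
elim: q p => [|y q IH] p /=; first by rewrite wnorm_nil expR0 mulr1.
apply: (le_trans (IH _)); rewrite wnorm_conj1w wnorm_cons expRD mulrA.
rewrite ler_wpM2r ?expR_ge0 // ler_wpM2l ?wnorm_ge0 //.
exact: expR_ge1Dx.
Qed.

Lemma wnorm_comm1w x q :
  (wnorm (comm1w x q) <= t ^+ x.2 * wnorm q * expR (wnorm q))%R.
Proof.
elim: q => [|y q IH] /=; first by rewrite wnorm_nil mulr0 mul0r.
rewrite wnorm_cat wnorm_cons mulrDr mulrDl addrC lerD //.
  rewrite (le_trans (wnorm_conjw _ _)) // wnorm_cons wnorm_nil addr0 /= exprD.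
  by rewrite ler_wpM2l ?mulr_ge0 ?exprn_ge0 // ler_expR lerDr exprn_ge0.
rewrite (le_trans IH) // ler_wpM2l ?mulr_ge0 ?exprn_ge0 ?wnorm_ge0 //.
by rewrite ler_expR lerDr exprn_ge0.
Qed.

Lemma wnorm_commw p q :
  (wnorm (commw p q)
   <= wnorm p * wnorm q * expR (wnorm q) * expR (wnorm p))%R.
Proof.
elim: p => [|x p IH] /=; first by rewrite wnorm_nil !mul0r.
rewrite wnorm_cat wnorm_cons 3!mulrDl lerD //.
  rewrite (le_trans (wnorm_conjw _ _)) // ler_pM ?wnorm_ge0 ?expR_ge0 //.
    exact: wnorm_comm1w.
  by rewrite ler_expR lerDr exprn_ge0.
rewrite (le_trans IH) // ler_wpM2l ?mulr_ge0 ?wnorm_ge0 ?expR_ge0 //.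
by rewrite ler_expR lerDr exprn_ge0.
Qed.

End WordNorm.

(** * Word balls *)

Section Balls.
Variables (G : groupType) (S : seq G).

(** Inverses are not built in; [ballV] obtains them from the symmetry of [S]. *)
Definition ball (n : nat) (g : G) : Prop :=
  exists s : seq G,
    [/\ {subset s <= S}, (size s <= n)%N & g = \prod_(x <- s) x].

Lemma ball1 n : ball n 1.
Proof. by exists [::]; split; rewrite ?big_nil. Qed.

Lemma ball_gen x : x \in S -> ball 1 x.
Proof.
move=> Sx; exists [:: x]; split=> [y||] //; first by rewrite inE => /eqP->.
by rewrite big_seq1.
Qed.

Lemma ballW m n g : (m <= n)%N -> ball m g -> ball n g.
Proof. by move=> lemn [s [sS ss ->]]; exists s; split=> //; exact: leq_trans lemn. Qed.

Lemma ballM m n g h : ball m g -> ball n h -> ball (m + n) (g * h).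
Proof.
move=> [s [sS ss ->]] [r [rS sr ->]]; exists (s ++ r); split.
- by move=> x; rewrite mem_cat => /orP[/sS|/rS].
- by rewrite size_cat leq_add.
- by rewrite big_cat.
Qed.

Lemma ballX n g k : ball n g -> ball (k * n) (g ^+ k).
Proof.
move=> Bg; elim: k => [|k IH]; first exact: ball1.
by rewrite expgS mulSn; exact: ballM.
Qed.

Hypothesis symS : {in S, forall x, x^-1 \in S}.

Lemma ballV n g : ball n g -> ball n g^-1.
Proof.
move=> [s [sS ss ->]]; elim: s n sS ss => [|x s IH] n sS ss.
  by rewrite big_nil invg1; exact: ball1.
rewrite big_cons invgM; case: n ss => // n ss; rewrite -addn1.
apply: ballM; first by apply: IH => // y sy; apply: sS; rewrite inE sy orbT.
by apply/ball_gen/symS/sS; rewrite mem_head.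
Qed.

Lemma ballR m n g h : ball m g -> ball n h -> ball (2 * (m + n)) [~ g, h].
Proof.
move=> Bg Bh; rewrite /commg /conjg mulgA -[X in X * _]invgM.
rewrite mul2n -addnn [X in (X + _)%N]addnC.
by apply: ballM; [exact/ballV/ballM | exact: ballM].
Qed.

End Balls.

(** * Iterated commutators as letters *)

Section Letters.
Variables (G : groupType) (S : seq G).
Implicit Types (x y z c : G * nat) (p q v : seq (G * nat)).

Inductive letter : G * nat -> Prop :=
| letter_gen g : g \in S -> letter (g, 1%N)
| letter_comm x y : letter x -> letter y -> letter (lcomm x y).

Definition lword p : Prop := {in p, forall x, letter x}.

Lemma letter_gt0 x : letter x -> (0 < x.2)%N.
Proof. by elim=> // {}x y _ x0 _ y0; rewrite /= addn_gt0 x0. Qed.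

Lemma letter_inv x :
  {in S, forall g, g^-1 \in S} -> letter x -> letter (linv x).
Proof.
move=> symS; elim=> [g Sg|{}x y lx _ ly _]; first exact/letter_gen/symS.
have -> : linv (lcomm x y) = lcomm y x by rewrite /linv /lcomm /= invgR addnC.
exact: letter_comm.
Qed.

(** Weights are positive, so a commutator of weight at most N + 1 has both entries of weight at most
    N. *)
Lemma letters_finite N :
  exists L : seq (G * nat), forall x, letter x -> (x.2 <= N)%N -> x \in L.
Proof.
elim: N => [|N [L LP]].
  by exists [::] => x /letter_gt0; rewrite leqn0; case: x.2.
exists ([seq (g, 1%N) | g <- S] ++ [seq lcomm x y | x <- L, y <- L]) => z.
case=> [g Sg _|x y lx ly /= leN]; rewrite mem_cat; apply/orP.
  by left; exact: map_f.
right; apply: allpairs_f; apply: LP => //.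
  by rewrite -ltnS (leq_trans _ leN) // -[X in (X < _)%N]addn0 ltn_add2l letter_gt0.
by rewrite -ltnS (leq_trans _ leN) // -[X in (X < _)%N]add0n ltn_add2r letter_gt0.
Qed.

Lemma lword_cons x p : letter x -> lword p -> lword (x :: p).
Proof. by move=> lx lp y; rewrite inE => /predU1P[->|/lp]. Qed.

Lemma lword_cat p q : lword p -> lword q -> lword (p ++ q).
Proof. by move=> lp lq y; rewrite mem_cat => /orP[/lp|/lq]. Qed.

Lemma lword_behead x p : lword (x :: p) -> letter x /\ lword p.
Proof.
by move=> lp; split=> [|y py]; apply: lp; rewrite inE ?eqxx ?py ?orbT.
Qed.

Lemma lword_nseq n x : letter x -> lword (nseq n x).
Proof. by move=> lx y; rewrite mem_nseq => /andP[_ /eqP->]. Qed.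

Lemma mem_conj1w p y z :
  z \in conj1w p y -> z \in p \/ exists2 x, x \in p & z = lcomm x y.
Proof.
case/flatten_mapP => x px; rewrite !inE => /orP[/eqP->|/eqP->]; first by left.
by right; exists x.
Qed.

Lemma mem_conjw p q z : lword p -> lword q -> z \in conjw p q ->
  letter z /\ (z \in p \/ exists2 x, x \in p & (x.2 < z.2)%N).
Proof.
elim: q p z => [|y q IH] p z lp lq /=; first by move=> pz; split; [exact: lp|left].
have [ly lq'] := lword_behead lq; have y0 := letter_gt0 ly.
have lp' : lword (conj1w p y).
  by move=> x /mem_conj1w[/lp//|[x' /lp lx' ->]]; exact: letter_comm.
move=> /(IH _ _ lp' lq')[lz hz]; split=> //.
have up x : x \in conj1w p y -> x \in p \/ exists2 x', x' \in p & (x'.2 < x.2)%N.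
  move=> /mem_conj1w[|[x' px' ->]]; first by left.
  by right; exists x' => //=; rewrite -[X in (X < _)%N]addn0 ltn_add2l.
case: hz => [/up//|[x /up[px|[x' px' lt']] lt]]; right; first by exists x.
by exists x' => //; exact: ltn_trans lt.
Qed.

Lemma lword_conjw p q : lword p -> lword q -> lword (conjw p q).
Proof. by move=> lp lq z /(mem_conjw lp lq)[]. Qed.

(** Every inserted commutator is strictly heavier than a letter of [p], hence than [c]. *)
Lemma count_conjw c p q : lword p -> lword q ->
  {in p, forall x, c.2 <= x.2}%N -> count_mem c (conjw p q) = count_mem c p.
Proof.
elim: q p => [|y q IH] p lp lq hp //=; have [ly lq'] := lword_behead lq.
have y0 := letter_gt0 ly.
rewrite IH //; first last.
- move=> x /mem_conj1w[/hp//|[x' /hp hx' ->]] /=.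
  exact: (leq_trans hx' (leq_addr _ _)).
- by move=> x /mem_conj1w[/lp//|[x' /lp lx' ->]]; exact: letter_comm.
elim: p lp hp {IH} => [|x p IHp] // /lword_behead[lx lp] hp.
rewrite [LHS]/= -/(conj1w p y) IHp //=; last by move=> z pz; rewrite hp // inE pz orbT.
congr (_ + _)%N; rewrite -[RHS]add0n; congr (_ + _)%N.
apply/eqP; rewrite eqb0; apply/negP => /eqP cE.
have := hp x (mem_head _ _); rewrite -cE /= leqNgt.
by rewrite -[X in (X < _)%N]addn0 ltn_add2l y0.
Qed.

(** Copies of [c] move to the front by x c^k = c^k x^(c^k), so every other letter is conjugated by
    the copies of [c] to its right. *)
Lemma extract_letter (R : realType) (t : R) c p : (0 <= t)%R ->
  letter c -> lword p -> {in p, forall x, c.2 <= x.2}%N ->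
  exists v, [/\ ev p = c.1 ^+ (count_mem c p) * ev v,
    (wnorm t v <= wnorm t p * expR (wnorm t p))%R, lword v &
    {in v, forall z, z != c /\ (z \in p \/ exists2 x, x \in p & x.2 < z.2)%N}].
Proof.
move=> t0 lc lp hp.
(* The sharper exponent counts only the copies of [c], which is what conjugating the head by the
   copies in the tail costs. *)
suff [v [ev_v nv lv hv]] : exists v, [/\ ev p = c.1 ^+ (count_mem c p) * ev v,
    (wnorm t v <= wnorm t p * expR (t ^+ c.2 *+ count_mem c p))%R, lword v &
    {in v, forall z, z != c /\ (z \in p \/ exists2 x, x \in p & x.2 < z.2)%N}].
  exists v; split=> //; apply: (le_trans nv); rewrite ler_wpM2l ?wnorm_ge0 //.
  by rewrite ler_expR wnorm_count.
elim: p lp hp => [|x p IH] lp hp.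
  by exists [::]; split=> //=; rewrite ?ev_nil ?mulg1 // wnorm_nil mul0r.
have [lx lp'] := lword_behead lp.
have [|v [ev_v nv lv hv]] := IH lp'; first by move=> z pz; rewrite hp // inE pz orbT.
have hv' : {in v, forall z, z != c /\
    (z \in x :: p \/ exists2 x', x' \in x :: p & x'.2 < z.2)%N}.
  move=> z /hv[zc hz]; split=> //; case: hz => [pz|[x' px' lt]].
    by left; rewrite inE pz orbT.
  by right; exists x' => //; rewrite inE px' orbT.
have le_exp k : (expR (t ^+ c.2 *+ k) <= expR (t ^+ c.2 *+ (k.+1)))%R.
  by rewrite ler_expR mulrS lerDr exprn_ge0.
have [xc|xc] := eqVneq x c.
  rewrite xc in hv' *; exists v; rewrite /= eqxx add1n; split=> //.
  - by rewrite ev_cons ev_v mulgA expgS.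
  - rewrite (le_trans nv) // ler_pM ?wnorm_ge0 ?expR_ge0 //.
    by rewrite wnorm_cons lerDr exprn_ge0.
have lxw : lword [:: x] by apply: lword_cons => // ? .
exists (conjw [:: x] (nseq (count_mem c p) c) ++ v).
rewrite /= (negbTE xc) add0n; split.
- rewrite ev_cons ev_cat ev_conjw ev_nseq [ev [:: x]]ev_cons ev_nil mulg1.
  by rewrite ev_v !mulgA mulgV mul1g.
- rewrite wnorm_cat wnorm_cons mulrDl lerD //.
  rewrite (le_trans (wnorm_conjw t0 _ _)) // wnorm_nseq wnorm_cons wnorm_nil.
  by rewrite addr0.
- by apply: lword_cat => //; apply: lword_conjw => //; exact: lword_nseq.
move=> z; rewrite mem_cat => /orP[|/hv'//].
move=> /(mem_conjw lxw (lword_nseq lc))[_].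
rewrite inE => -[/eqP->|[x']]; first by split=> //; left; rewrite mem_head.
rewrite inE => /eqP-> lt; split; last by right; exists x => //; rewrite mem_head.
(* A letter heavier than [x] is heavier than [c], so conjugation creates no new copy of [c]. *)
apply: contraTneq lt => ->; rewrite -leqNgt; exact/hp/mem_head.
Qed.

(** Modulo heavier letters the commutator is bilinear: a commutator of two letters has the weight of
    [lcomm c d] only if both are the leading ones, and conjugation adds only heavier letters. So
    each pair of leading letters contributes once. *)
Lemma commw_letters c d p q : lword p -> lword q ->
  {in p, forall x, x = c \/ c.2 < x.2}%N ->
  {in q, forall y, y = d \/ d.2 < y.2}%N ->
  [/\ lword (commw p q),
      {in commw p q, forall z, z = lcomm c d \/ (lcomm c d).2 < z.2}%N &
      count_mem (lcomm c d) (commw p q) = (count_mem c p * count_mem d q)%N].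
Proof.
move=> lp lq hp hq.
have hconj r s : lword r -> lword s ->
    {in r, forall z, z = lcomm c d \/ (lcomm c d).2 < z.2}%N ->
    [/\ lword (conjw r s),
      {in conjw r s, forall z, z = lcomm c d \/ (lcomm c d).2 < z.2}%N &
      count_mem (lcomm c d) (conjw r s) = count_mem (lcomm c d) r].
  move=> lr ls hr; split; first exact: lword_conjw.
    move=> z /(mem_conjw lr ls)[_ [/hr//|[x /hr hx lt]]]; right.
    by case: hx => [<-//|hx]; exact: ltn_trans lt.
  apply: count_conjw => // z /hr[->//|]; exact: ltnW.
have hxq x : letter x -> x = c \/ (c.2 < x.2)%N ->
    [/\ lword (comm1w x q),
      {in comm1w x q, forall z, z = lcomm c d \/ (lcomm c d).2 < z.2}%N &
      count_mem (lcomm c d) (comm1w x q) = ((x == c) * count_mem d q)%N].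
  move=> lx hx; elim: q lq hq => [|y q IH] lq hq; first by split=> //=; rewrite muln0.
  have [ly lq'] := lword_behead lq.
  have [|l1 h1 c1] := IH lq'; first by move=> z qz; apply: hq; rewrite inE qz orbT.
  have lxy : lword [:: lcomm x y].
    by move=> z; rewrite inE => /eqP->; exact: letter_comm.
  have hy := hq y (mem_head _ _).
  have [|l2 h2 c2] := hconj _ _ lxy lq'.
    move=> z; rewrite inE => /eqP->.
    case: hx hy => [->|hx] [->|hy]; [by left|right..] => /=.
    - by rewrite ltn_add2l.
    - by rewrite ltn_add2r.
    - by rewrite -addSn leq_add // ltnW.
  split=> /=; first exact: lword_cat.
    by move=> z; rewrite mem_cat => /orP[/h1|/h2].
  rewrite count_cat c1 c2 /= addn0 addnC mulnDr; congr (_ + _)%N.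
  have [->|xc] := eqVneq x c; last first.
    case: hx => [/eqP|hx]; first by rewrite (negbTE xc).
    rewrite mul0n; apply/eqP; rewrite eqb0; apply/negP => /eqP E.
    have : (c.2 + d.2 < x.2 + y.2)%N.
      by rewrite -addSn leq_add //; case: hy => [->//|/ltnW].
    by case: E => _ ->; rewrite ltnn.
  have [->|yd] := eqVneq y d; first by rewrite eqxx.
  case: hy => [/eqP|hy]; first by rewrite (negbTE yd).
  rewrite muln0; apply/eqP; rewrite eqb0; apply/negP => /eqP E.
  have : (c.2 + d.2 < c.2 + y.2)%N by rewrite ltn_add2l.
  by case: E => _ ->; rewrite ltnn.
elim: p lp hp => [|x p IH] lp hp; first by [].
have [lx lp'] := lword_behead lp.
have [|l1 h1 c1] := IH lp'; first by move=> z pz; apply: hp; rewrite inE pz orbT.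
have [l2 h2 c2] := hxq x lx (hp _ (mem_head _ _)).
have [l3 h3 c3] := hconj _ _ l2 lp' h2.
split=> /=; first exact: lword_cat.
  by move=> z; rewrite mem_cat => /orP[/h3|/h1].
by rewrite count_cat c1 c3 c2 mulnDl.
Qed.

End Letters.

(** * Collection and covering by translates *)

Section Collection.
Variables (G : groupType) (S : seq G) (R : realType).
Hypothesis symS : {in S, forall g, g^-1 \in S}.
Implicit Types (x y z c : G * nat) (p q v D : seq (G * nat)).

(* The commutator of two such words multiplies the exponents of the leading
   letters: [x ^+ (n ^ i)] and [y ^+ (n ^ j)] give [~ x, y] ^+ (n ^ (i + j)),
   at the cost of doubling lengths only. *)
Lemma letter_power_word c : letter S c ->
  exists (C : nat) (K : R), forall n, (0 < n)%N -> exists p,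
    [/\ lword S p, {in p, forall z, z = c \/ c.2 < z.2}%N,
        count_mem c p = (n ^ c.2)%N, (wnorm (n%:R^-1) p <= K)%R &
        ball S (C * n) (ev p)].
Proof.
elim=> [g Sg|x y lx [Cx [Kx hx]] ly [Cy [Ky hy]]].
  exists 1%N, 1%R => n n0; exists (nseq n (g, 1%N)); split.
  - exact/lword_nseq/letter_gen.
  - by move=> z; rewrite mem_nseq => /andP[_ /eqP->]; left.
  - by rewrite count_nseq /= eqxx mul1n expn1.
  - by rewrite wnorm_nseq /= expr1 -[leLHS]mulr_natl divff // pnatr_eq0 -lt0n.
  by rewrite ev_nseq /= mul1n -[X in ball _ X]muln1; exact/ballX/ball_gen.
exists (2 * (Cx + Cy))%N, (Kx * Ky * expR Ky * expR Kx)%R => n n0.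
have [p [lp hp cp np bp]] := hx n n0; have [q [lq hq cq nq bq]] := hy n n0.
have [l h cnt] := commw_letters lp lq hp hq.
have t0 : (0 <= n%:R^-1 :> R)%R by rewrite invr_ge0 ler0n.
exists (commw p q); split => //; first by rewrite cnt cp cq expnD.
  rewrite (le_trans (wnorm_commw t0 _ _)) //.
  have [p0 q0] := (wnorm_ge0 t0 p, wnorm_ge0 t0 q).
  by rewrite !ler_pM ?mulr_ge0 ?expR_ge0 ?ler_expR.
by rewrite ev_commw -mulnA mulnDl; exact: ballR.
Qed.

Variable N : nat.
Hypothesis nilS : forall x, letter S x -> (N < x.2)%N -> x.1 = 1.

(** Only strictly heavier letters are required, so that letters of equal weight can be removed from
    [D] one at a time. *)
Definition upclosed D : Prop := forall x z,
  x \in D -> letter S z -> (x.2 < z.2)%N -> (z.2 <= N)%N -> z \in D.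

Local Notation lighter := (fun x y : G * nat => (x.2 <= y.2)%N).

Lemma lighter_head c D x :
  sorted lighter (c :: D) -> x \in c :: D -> (c.2 <= x.2)%N.
Proof.
have tr : transitive lighter by move=> y x' z; exact: leq_trans.
rewrite /= (path_sortedE tr) inE => /andP[/allP hD _] /orP[/eqP->//|/hD//].
Qed.

Lemma upclosed_behead c D :
  sorted lighter (c :: D) -> upclosed (c :: D) -> upclosed D.
Proof.
move=> sD uD x z Dx lz lt leN; have cx : x \in c :: D by rewrite inE Dx orbT.
have := uD x z cx lz lt leN; rewrite inE => /orP[/eqP zc|//].
by have := lighter_head sD cx; rewrite -zc leqNgt lt.
Qed.

Lemma trim_word (t : R) p : (0 <= t)%R -> lword S p -> exists v,
  [/\ ev v = ev p, (wnorm t v <= wnorm t p)%R, lword S v &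
      {in v, forall z, z \in p /\ (z.2 <= N)%N}].
Proof.
move=> t0 lp; exists [seq x <- p | (x.2 <= N)%N]; split.
- elim: p lp => [|x p IH] // /lword_behead[lx lp]; rewrite /= [RHS]ev_cons.
  case: leqP => [_|/(nilS lx)->]; first by rewrite ev_cons IH.
  by rewrite mul1g IH.
- exact: wnorm_filter.
- by move=> z; rewrite mem_filter => /andP[_ /lp].
by move=> z; rewrite mem_filter => /andP[].
Qed.

(** This is the inductive step shared by [word_ball] and [word_cover]. Collection may create letters
    outside [D], but those of weight above [N] are trivial and are deleted, and up-closedness
    captures the others. *)
Lemma extract_head (t : R) c D p : (0 <= t)%R -> letter S c ->
  upclosed (c :: D) -> lword S p ->
  {in p, forall z, (c.2 <= z.2)%N /\ (z \in c :: D \/ (c.2 < z.2)%N)} ->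
  exists v, [/\ ev p = c.1 ^+ (count_mem c p) * ev v,
    (wnorm t v <= wnorm t p * expR (wnorm t p))%R, lword S v &
    {subset v <= D}].
Proof.
move=> t0 lc uD lp hp.
have [|v' [ev' nv' lv' hv']] := extract_letter t0 lc lp; first by move=> z /hp[].
have [v [ev_v nv lv hv]] := trim_word t0 lv'.
exists v; split=> //; [by rewrite ev_v | exact: le_trans nv' |].
move=> z vz; have [v'z zN] := hv z vz; have [zc hz] := hv' z v'z.
have cD : c \in c :: D := mem_head _ _.
suff : z \in c :: D by rewrite inE (negbTE zc).
case: hz => [/hp[_ [//|lt]]|[x /hp[lex _] lt]]; apply: (uD c) => //.
- exact: lv.
- exact: lv.
exact: leq_ltn_trans lt.
Qed.

(** Expand [a] in base 2^j: the digit at place i costs at most 2^j C 2^i, and the geometric sum over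
    i < k is at most 2^j C 2^k. *)
Lemma ball_digits C j (g : G) :
  (forall k, ball S (C * 2 ^ k) (g ^+ ((2 ^ k) ^ j))) ->
  forall k a, (a < (2 ^ k) ^ j)%N -> ball S (2 ^ j * C * 2 ^ k) (g ^+ a).
Proof.
move=> hC; elim=> [|k IH] a.
  by rewrite expn0 exp1n ltnS leqn0 => /eqP->; exact: ball1.
move=> lta; rewrite (divn_eq a ((2 ^ k) ^ j)) expgnDr.
rewrite [X in ball _ X](_ : _ = 2 ^ j * C * 2 ^ k + 2 ^ j * C * 2 ^ k)%N; last first.
  by rewrite expnS mulnCA mul2n addnn.
apply: ballM; last by apply: IH; rewrite ltn_mod !expn_gt0.
rewrite [(_ %/ _ * _)%N]mulnC expgnA.
apply: (@ballW _ _ (a %/ (2 ^ k) ^ j * (C * 2 ^ k))).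
  rewrite -mulnA leq_mul2r; apply/orP; right.
  by rewrite ltnW // ltn_divLR ?expn_gt0 // -expnMn -expnS.
exact: ballX.
Qed.

Local Notation scale k := ((2 ^ k)%N%:R^-1 : R)%R.

Lemma scale_ge0 k : (0 <= scale k)%R.
Proof. by rewrite invr_ge0 ler0n. Qed.

Lemma scale_count c p k (K : R) : (wnorm (scale k) p <= K)%R ->
  ((count_mem c p)%:R <= K * ((2 ^ k) ^ c.2)%N%:R)%R.
Proof.
move=> /(le_trans (wnorm_count (scale_ge0 k) c p)).
by rewrite -[X in (X <= _)%R]mulr_natl exprVn -natrX ler_pdivrMr // ltr0n !expn_gt0.
Qed.

(** Induction on [D], removing its lightest letter [c]. Extracting [c] enlarges the norm, so the
    induction hypothesis is kept for all [K]. *)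
Lemma word_ball D : sorted lighter D -> lword S D -> upclosed D ->
  forall K : R, exists C, forall k p, {subset p <= D} ->
    (wnorm (scale k) p <= K)%R -> ball S (C * 2 ^ k) (ev p).
Proof.
elim: D => [|c D IH] sD lD uD K.
  exists 0%N => k [|x p] pD _; first by rewrite ev_nil; exact: ball1.
  by have := pD x (mem_head _ _).
have [lc lD'] := lword_behead lD.
have {}IH := IH (path_sorted sD) lD' (upclosed_behead sD uD).
have [C0 [K0 h0]] := letter_power_word lc.
(* [C1] serves the heavier letters left over when [c.1] is raised to the power (2^k)^w, where w is
   the weight of [c]; [C2] serves the rest of the given word. *)
have [C1 h1] := IH (K0 * expR K0)%R; have [C2 h2] := IH (K * expR K)%R.
have mono (n K' : R) : (0 <= n -> n <= K' -> n * expR n <= K' * expR K')%R.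
  by move=> n0 nK; rewrite ler_pM ?expR_ge0 ?ler_expR.
have hc k : ball S ((C0 + C1) * 2 ^ k) (c.1 ^+ ((2 ^ k) ^ c.2)).
  have k0 : (0 < 2 ^ k)%N by rewrite expn_gt0.
  have [p [lp hp cp np bp]] := h0 _ k0.
  have [|v [ev_p nv lv vD]] := extract_head (scale_ge0 k) lc uD lp.
    move=> z /hp[->|lt]; first by rewrite mem_head; split=> //; left.
    by rewrite ltnW //; split=> //; right.
  have -> : c.1 ^+ ((2 ^ k) ^ c.2) = ev p * (ev v)^-1 by rewrite ev_p cp mulgK.
  rewrite mulnDl; apply: ballM => //; apply/ballV/h1 => //.
  exact/(le_trans nv)/mono/np/wnorm_ge0/scale_ge0.
(* Since K < 2^e <= (2^e)^w, the exponent of [c] is below (2^(e+k))^w, and [ball_digits] applies at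
   scale e + k. *)
pose e := Num.bound K.
exists (2 ^ c.2 * (C0 + C1) * 2 ^ e + C2)%N => k p pD np.
have n0 := wnorm_ge0 (scale_ge0 k) p.
have lp : lword S p by move=> z /pD/lD.
have [|v [-> nv lv vD]] := extract_head (scale_ge0 k) lc uD lp.
  by move=> z /pD cz; split; [exact: lighter_head cz | left].
rewrite mulnDl; apply: ballM; last by apply: h2 => //; exact/(le_trans nv)/mono.
rewrite -mulnA -expnD; apply: ball_digits hc _ _ _.
rewrite -(ltr_nat R) (le_lt_trans (scale_count c np)) // expnD expnMn natrM.
rewrite ltr_pM2r ?ltr0n ?expn_gt0 //.
rewrite (lt_le_trans (archi_boundP (le_trans n0 np))) // ler_nat -/e.
rewrite (leq_trans (ltnW (ltn_expl e (ltnSn 1)))) // -{1}[(2 ^ e)%N]expn1.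
by rewrite leq_pexp2l ?expn_gt0 // (letter_gt0 lc).
Qed.

(** [M] can be chosen before [K]: a remainder of [c] has norm at most 1, so each letter of [D] adds
    to [M] the constant of [word_ball] for norm 1, while [K] affects only the number of
    translates. *)
Lemma word_cover D : sorted lighter D -> lword S D -> upclosed D ->
  exists M, forall K : R, exists l, forall k, exists X : seq G,
    (size X <= l)%N /\ forall p, {subset p <= D} -> (wnorm (scale k) p <= K)%R ->
      exists g b, [/\ g \in X, ball S (M * 2 ^ k) b & ev p = g * b].
Proof.
elim: D => [|c D IH] sD lD uD.
  exists 0%N => K; exists 1%N => k; exists [:: 1]; split=> // -[|x p] pD _.
    by exists 1, 1; rewrite mem_head ev_nil mulg1; split=> //; exact: ball1.
  by have := pD x (mem_head _ _).
have [lc lD'] := lword_behead lD; have uD' := upclosed_behead sD uD.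
have {IH} [M' IH] := IH (path_sorted sD) lD' uD'.
have [M hM] := word_ball sD lD uD 1%R.
have hc k r : (r < (2 ^ k) ^ c.2)%N -> (scale k ^+ c.2 *+ r <= 1)%R.
  move=> ltr; rewrite -[leLHS]mulr_natl exprVn -natrX.
  by rewrite ler_pdivrMr ?ltr0n ?expn_gt0 // mul1r ler_nat ltnW.
(* [K * expR K] pays for extracting [c], and [expR 1] for moving the remainder past the rest of the
   word. *)
exists (M' + M)%N => K; have [l hl] := IH (K * expR K * expR 1)%R.
pose Q := (Num.bound K).+1; exists (Q * l)%N => k; have [X [sX hX]] := hl k.
pose m := ((2 ^ k) ^ c.2)%N.
have m0 : (0 < m)%N by rewrite !expn_gt0.
exists [seq (c.1 ^+ m) ^+ i * g | i <- iota 0 Q, g <- X]; split.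
  by rewrite size_allpairs size_iota leq_mul2l sX orbT.
move=> p pD np; have t0 := scale_ge0 k; have n0 := wnorm_ge0 t0 p.
have lp : lword S p by move=> z /pD/lD.
have [|v [-> nv lv vD]] := extract_head t0 lc uD lp.
  by move=> z /pD cz; split; [exact: lighter_head cz | left].
have := scale_count c np; set a := count_mem c p; rewrite -/m => ha.
set r := (a %% m)%N; have ltr : (r < m)%N by rewrite ltn_mod.
(* The remainder moves to the right by c^r v = (c^r v c^(-r)) c^r, a conjugation by copies of the
   inverse letter. *)
have lc' := letter_inv symS lc.
have lconj : lword S (conjw v (nseq r (linv c))).
  by apply: lword_conjw => //; exact: lword_nseq.
have [w [ev_w nw lw hw]] := trim_word t0 lconj.
have wD : {subset w <= D}.
  move=> z wz; have [vz zN] := hw z wz.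
  have [_ [/vD//|[x /vD Dx lt]]] := mem_conjw lv (lword_nseq lc') vz.
  by apply: (uD' x) => //; exact: lw.
have [|g [b [Xg bb gb]]] := hX w wD.
  rewrite (le_trans nw) // (le_trans (wnorm_conjw t0 _ _)) //.
  rewrite ler_pM ?wnorm_ge0 ?expR_ge0 //.
    by rewrite (le_trans nv) // ler_pM ?expR_ge0 ?ler_expR.
  by rewrite ler_expR wnorm_nseq hc.
exists ((c.1 ^+ m) ^+ (a %/ m) * g), (b * c.1 ^+ r); split.
- apply: allpairs_f => //; rewrite mem_iota /= add0n ltnS.
  rewrite -(ler_nat R) ltW // (le_lt_trans _ (archi_boundP (le_trans n0 np))) //.
  rewrite -(ler_pM2r (_ : 0 < m%:R :> R)%R) ?ltr0n // (le_trans _ ha) //.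
  by rewrite -natrM ler_nat leq_divM.
- rewrite mulnDl; apply: ballM => //; rewrite -(ev_nseq r c).
  apply: hM; first by move=> z; rewrite mem_nseq => /andP[_ /eqP->]; exact: mem_head.
  by rewrite wnorm_nseq hc.
rewrite !mulgA -[_ * g * b]mulgA -gb ev_w ev_conjw ev_nseq /= expVgn.
rewrite /conjg invgK !mulgA mulgVK.
by rewrite -expgnA -expgnDr [(m * _)%N]mulnC -divn_eq.
Qed.

End Collection.

(** * Subgroups and the lower central series *)

Section Subgroups.
Variable G : groupType.
Implicit Types (H E : set G).

Lemma subgroupP H :
  subgroup H <-> H 1 /\ forall x y, H x -> H y -> H (x * y^-1).
Proof.
split=> [[H1 HV]|[H1 HV]].
  split=> [|x y Hx Hy]; first by move: H1; rewrite inE.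
  by have := HV x y; rewrite !inE; exact.
by split=> [|x y]; rewrite !inE //; exact: HV.
Qed.

Lemma subgroup1 H : subgroup H -> H 1.
Proof. by case/subgroupP. Qed.

Lemma subgroupV H x : subgroup H -> H x -> H x^-1.
Proof. by case/subgroupP=> H1 HV Hx; rewrite -[_^-1]mul1g; exact: HV. Qed.

Lemma subgroupM H x y : subgroup H -> H x -> H y -> H (x * y).
Proof.
move=> sH Hx Hy; rewrite -[y]invgK; have [_ HV] := (subgroupP H).1 sH.
by apply: HV => //; exact: subgroupV.
Qed.

Lemma subgroupJ H x y : subgroup H -> H x -> H y -> H (x ^ y).
Proof.
by move=> sH Hx Hy; apply: subgroupM (subgroupV _ _) (subgroupM _ _ _).
Qed.

Lemma subgroupR H x y : subgroup H -> H x -> H y -> H [~ x, y].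
Proof.
by move=> sH Hx Hy; apply: subgroupM (subgroupV _ _) (subgroupJ _ _ _).
Qed.

Lemma subgroup_gen E : subgroup (gen_set E).
Proof.
apply/subgroupP; split=> [|x y Ex Ey] M [sM EM]; first exact: subgroup1.
by apply: subgroupM (subgroupV _ _) => //; [exact: Ex | exact: Ey].
Qed.

Section LowerCentral.
Variable H : set G.
Hypothesis sH : subgroup H.

Lemma subgroup_lower_central n : subgroup (lower_central H n).
Proof. by case: n => [|n] //; exact: subgroup_gen. Qed.

Lemma lower_central_comm1 n x y :
  lower_central H n x -> H y -> lower_central H n.+1 [~ x, y].
Proof. by move=> Hx Hy; apply: sub_gen_smallest; exists x => //; exists y. Qed.

Lemma lower_central_sub n : lower_central H n `<=` H.
Proof.
elim: n => [|n IH] //; apply: smallest_sub => // _ [x Hx [y Hy <-]].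
exact: subgroupR (IH _ Hx) Hy.
Qed.

(** Conjugation by [h] sends a generator [x, y] to [x^h, y^h], so the elements with all conjugates
    inside form a subgroup containing the generators. *)
Lemma lower_centralJ n x h :
  lower_central H n x -> H h -> lower_central H n (x ^ h).
Proof.
elim: n x h => [|n IH] x h; first exact: subgroupJ.
move=> Hx; move: x Hx h.
suff : lower_central H n.+1 `<=`
    [set x | forall h, H h -> lower_central H n.+1 (x ^ h)].
  by [].
have sg := subgroup_lower_central n.+1.
apply: smallest_sub.
  apply/subgroupP; split=> [h _|x y hx hy h Hh].
    by rewrite conj1g; exact: subgroup1.
  rewrite conjMg conjVg.
  exact: (subgroupM sg (hx _ Hh) (subgroupV sg (hy _ Hh))).
move=> _ [x Hx [y Hy <-]] h Hh; rewrite conjRg.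
by apply: lower_central_comm1; [exact: IH | exact: subgroupJ].
Qed.

Lemma lower_central_commV n x y : lower_central H n [~ x, y] -> H y ->
  lower_central H n [~ x, y^-1].
Proof.
move=> Hxy Hy; have sg := subgroup_lower_central n.
have -> : [~ x, y^-1] = ([~ x, y]^-1) ^ y^-1.
  by rewrite invgR /commg /conjg !invgK !mulgA mulgV mul1g.
by apply: lower_centralJ; apply: subgroupV.
Qed.

(** The three subgroups argument, by induction on [j]. As indices start at 0, this is the inclusion
    of [gamma_i, gamma_j] in gamma_(i+j). *)
Lemma lower_central_comm i j x y :
  lower_central H i x -> lower_central H j y ->
  lower_central H (i + j).+1 [~ x, y].
Proof.
elim: j i x y => [|j IH] i x y Hx; first by rewrite addn0; exact: lower_central_comm1.
move=> Hy; move: y Hy x Hx; pose n := (i + j.+1).+1; rewrite -/n.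
have sg := subgroup_lower_central n.
(* Membership in [H] is carried along because closure under quotients conjugates by elements of this
   set. *)
suff : lower_central H j.+1 `<=` H `&` [set y |
    forall x, lower_central H i x -> lower_central H n [~ x, y]].
  by move=> + y Hy => /(_ y Hy)[].
apply: smallest_sub.
  apply/subgroupP; split.
    by split=> [|x _]; [exact: subgroup1 | rewrite commg1; exact: subgroup1].
  move=> y z [Hy hy] [Hz hz]; have HVz := subgroupV sH Hz; split=> [|x Hx].
    exact: subgroupM.
  rewrite commgMJ; apply: (subgroupM sg).
    by apply: lower_central_commV => //; exact: hz.
  by apply: lower_centralJ => //; exact: hy.
move=> _ [u Hu [h Hh <-]]; have HHu := lower_central_sub Hu.
split=> [|x Hx]; first exact: subgroupR.
have HHx := lower_central_sub Hx; have HhV := subgroupV sH Hh.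
rewrite -invgR; apply: (subgroupV sg).
(* The other two factors are conjugates of [h^-1, x^-1, u] and [x, u^-1, h^-1], both within reach of
   the induction hypothesis. *)
have := Hall_Witt_identity u h^-1 x; rewrite !invgK => /eqP.
rewrite -mulgA mulg_eq1 => /eqP E.
rewrite -[[~ _, _, _]](conjgK h^-1) E invgK.
apply: lower_centralJ => //; apply: (subgroupV sg); apply: (subgroupM sg).
  apply: lower_centralJ => //; rewrite /n addnS -addSn; apply: IH => //.
  rewrite -invgR; apply: (subgroupV (subgroup_lower_central _)).
  apply: lower_central_comm1 => //.
  exact: (subgroupV (subgroup_lower_central _)).
apply: lower_centralJ => //; apply: lower_central_comm1 => //.
rewrite addnS; apply: IH => //; exact: (subgroupV (subgroup_lower_central _)).
Qed.


End LowerCentral.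
End Subgroups.

(** * The covering in a nilpotent subgroup *)

Lemma letter_lower_central (G : groupType) (H : set G) (S : seq G) x :
  subgroup H -> {in S, forall g, H g} -> letter S x ->
  lower_central H x.2.-1 x.1.
Proof.
move=> sH SH; elim=> [g /SH//|y z ly IHy lz IHz] /=.
have := lower_central_comm sH IHy IHz.
by rewrite -addSn prednK ?(letter_gt0 ly) // -{2}(prednK (letter_gt0 lz)) addnS.
Qed.

Lemma lower_central_trivial (G : groupType) (H : set G) c n :
  lower_central H c = [set 1] -> (c <= n)%N -> lower_central H n `<=` [set 1].
Proof.
move=> Hc; elim: n => [|n IH]; first by rewrite leqn0 => /eqP <-; rewrite Hc.
rewrite leq_eqVlt => /orP[/eqP<-|/IH Hn]; first by rewrite Hc.
apply: smallest_sub => [|_ [x /Hn-> [y _ <-]]]; last exact: comm1g.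
by apply/subgroupP; split=> // x y -> ->; rewrite invg1 mulg1.
Qed.

Lemma nilpotent_ball_cover (G : groupType) (H : set G) (S : seq G) :
  subgroup H -> nilpotent_set H -> {in S, forall g, H g} ->
  {in S, forall g, g^-1 \in S} ->
  exists M, forall K, exists l, forall k, exists X : seq G,
    (size X <= l)%N /\ forall g, ball S (K * 2 ^ k) g ->
      exists x b, [/\ x \in X, ball S (M * 2 ^ k) b & g = x * b].
Proof.
move=> sH [c Hc] SH symS.
(* The weight bound is c + 1 so that generators, of weight 1, are kept even if c = 0. *)
have nilS x : letter S x -> (c.+1 < x.2)%N -> x.1 = 1.
  move=> lx lt; apply: (lower_central_trivial Hc) (letter_lower_central sH SH lx).
  by rewrite -ltnS prednK ?(letter_gt0 lx) // ltnW.
have [L hL] := letters_finite S c.+1.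
pose lighter (x y : G * nat) := (x.2 <= y.2)%N.
pose D := sort lighter [seq x <- L | `[< letter S x >] & (x.2 <= c.+1)%N].
have DP x : reflect (letter S x /\ (x.2 <= c.+1)%N) (x \in D).
  rewrite mem_sort mem_filter -andbA; apply: (iffP and3P).
    by case=> /asboolP.
  by case=> lx lex; split=> //; [exact/asboolP | exact: hL].
have [||x z _ lz _ lez|M hM] := @word_cover _ _ Rdefinitions.R symS _ nilS D.
- by apply: sort_sorted => x y; exact: leq_total.
- by move=> x /DP[].
- exact/DP.
exists M => K; have [l hl] := hM K%:R%R; exists l => k.
have [X [sX hX]] := hl k; exists X; split=> // _ [s [sS ss ->]].
(* At most K 2^k letters of weight 1 have total norm at most K. *)
have [||x [b [Xx bb E]]] := hX [seq (g, 1%N) | g <- s].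
- by move=> _ /mapP[g /sS Sg ->]; apply/DP; split=> //; exact: letter_gen.
- rewrite /wnorm big_map /= big_const_seq count_predT iter_addr_0 expr1.
  rewrite -[leLHS]mulr_natl ler_pdivrMr ?ltr0n ?expn_gt0 //.
  by rewrite -natrM ler_nat.
by exists x, b; split=> //; rewrite -E /ev big_map.
Qed.

(** * Passage to a subgroup of finite index *)

Lemma ball_trans (G : groupType) (A S : seq G) C n g :
  {in S, forall s, ball A C s} -> ball S n g -> ball A (n * C) g.
Proof.
move=> SC [s [sS ss ->]]; apply: (@ballW _ _ (size s * C)).
  by rewrite leq_mul2r ss orbT.
elim: s sS {ss} => [|x s IH] sS; first by rewrite big_nil; exact: ball1.
rewrite big_cons /= mulSn; apply: ballM; first exact/SC/sS/mem_head.
by apply: IH => y sy; apply: sS; rewrite inE sy orbT.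
Qed.

Lemma ball_uniform (G : groupType) (A S : seq G) :
  {in S, forall s, exists n, ball A n s} ->
  exists C, {in S, forall s, ball A C s}.
Proof.
elim: S => [|x S IH] h; first by exists 0%N.
have [|C hC] := IH; first by move=> y Sy; apply: h; rewrite inE Sy orbT.
have [n hn] := h x (mem_head _ _); exists (maxn n C) => y.
rewrite inE => /orP[/eqP->|/hC]; last exact/ballW/leq_maxr.
exact: (ballW (leq_maxl _ _) hn).
Qed.

(* Schreier's argument: rewriting [a * t = t' * s] with [t, t'] in a transversal
   turns a product of generators into a transversal element times a product
   of the same length in the finite set [S] of such [s]. *)
Lemma schreier (G : groupType) (H : set G) (A : seq G) :
  subgroup H -> finite_index H -> {in A, forall a, a^-1 \in A} ->
  exists (T S : seq G) (C : nat), [/\ {in S, forall g, H g},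
    {in S, forall g, g^-1 \in S}, {in S, forall s, ball A C s} &
    forall n g, ball A n g -> exists t s, [/\ t \in T, ball S n s & g = t * s]].
Proof.
move=> sH /finite_seqP[cosets hcosets] symA.
pose Gam g := exists n, ball A n g.
have GM g h : Gam g -> Gam h -> Gam (g * h).
  by move=> [m hm] [n hn]; exists (m + n)%N; exact: ballM.
have GV g : Gam g -> Gam g^-1 by move=> [m hm]; exists m; exact: ballV.
pose P (B : set G) := [set g | Gam g /\ left_coset H g = B].
(* Representatives are taken among products of elements of [A], so that the Schreier generators are
   such products too. A coset containing none gets the default 1, and the leading 1 starts the final
   induction. *)
pose T := 1 :: [seq xget 1 (P B) | B <- cosets].
have TG t : t \in T -> Gam t.
  rewrite inE => /orP[/eqP->|/mapP[B _ ->]]; first by exists 0%N; exact: ball1.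
  by case: xgetP => [g -> []|_] //; exists 0%N; exact: ball1.
have TP g : Gam g -> exists2 t, t \in T & H (t^-1 * g).
  move=> Gg; pose B := left_coset H g; pose t := xget 1 (P B).
  have cB : B \in cosets.
    have : range (left_coset H) B by exists g.
    by rewrite hcosets.
  exists t; first by rewrite inE; apply/orP; right; exact: map_f.
  have [_ tB] : P B t by apply: xgetPex; exists g.
  have : left_coset H g g by exists 1; rewrite ?mulg1 //; exact: subgroup1.
  by rewrite -/B -tB => -[y Hy <-]; rewrite mulKg.
pose U := [seq t'^-1 * u | t' <- T, u <- [seq a * t | a <- A, t <- T]].
pose S0 := [seq s <- U | `[< H s >]].
have S0P s : s \in S0 -> H s /\ Gam s.
  rewrite mem_filter => /andP[/asboolP Hs /allpairsP[[t' u] [Tt' Uu E]]].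
  split=> //; rewrite {}E; have /allpairsP[[a t] [Aa Tt ->]] := Uu.
  rewrite /= in Tt' Aa Tt *; apply: (GM); [exact/GV/TG|].
  by apply: GM (TG _ Tt); exists 1%N; exact: ball_gen.
pose S := S0 ++ [seq s^-1 | s <- S0].
have SP s : s \in S -> H s /\ Gam s.
  rewrite mem_cat => /orP[/S0P//|/mapP[s' /S0P[Hs Gs] ->]].
  by split; [exact: subgroupV | exact: GV].
have [|C hC] := @ball_uniform _ A S; first by move=> s /SP[].
exists T, S, C; split=> // [g /SP[]//|g|n g [s [sA ss ->]]].
  rewrite !mem_cat => /orP[Sg|/mapP[s Ss ->]]; last by rewrite invgK Ss.
  by rewrite map_f ?orbT.
elim: s n sA ss => [|a s IH] n sA ss.
  by exists 1, 1; rewrite mem_head big_nil mulg1; split=> //; exact: ball1.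
case: n ss => // n ss.
have [|t [s' [Tt bs' E]]] := IH n _ ss.
  by move=> y sy; apply: sA; rewrite inE sy orbT.
have Aa := sA a (mem_head _ _).
have [|t' Tt' Ht'] := TP (a * t).
  by apply: GM (TG _ Tt); exists 1%N; exact: ball_gen.
exists t', (t'^-1 * (a * t) * s'); split=> //.
  rewrite -add1n; apply: ballM bs'; apply: ball_gen.
  rewrite mem_cat mem_filter; apply/orP; left; apply/andP; split.
    exact/asboolP.
  by apply: allpairs_f => //; exact: allpairs_f.
by rewrite big_cons E !mulgA mulgV mul1g.
Qed.

(** The transversal goes into the translates, and returning from [S] to [A] multiplies the radius by
    [C]; so [M] remains independent of [K]. *)
Lemma ball_cover (G : groupType) (A : seq G) :
  virtually_nilpotent G -> {in A, forall a, a^-1 \in A} ->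
  exists M, forall K, exists l, forall k, exists X : seq G,
    (size X <= l)%N /\ forall g, ball A (K * 2 ^ k) g ->
      exists x b, [/\ x \in X, ball A (M * 2 ^ k) b & g = x * b].
Proof.
move=> [H [sH nH fH]] symA.
have [T [S [C [SH symS SA hT]]]] := schreier sH fH symA.
have [M hM] := nilpotent_ball_cover sH nH SH symS.
exists (M * C)%N => K; have [l hl] := hM K; exists (size T * l)%N => k.
have [X [sX hX]] := hl k; exists [seq t * x | t <- T, x <- X]; split.
  by rewrite size_allpairs leq_mul2l sX orbT.
move=> g /hT[t [s [Tt /hX[x [b [Xx bb ->]]] ->]]].
exists (t * x), b; split; [exact: allpairs_f | | by rewrite mulgA].
by rewrite mulnAC; exact: ball_trans SA bb.
Qed.

(** * Products of exact length and the theorem *)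

Lemma exp_setP (G : groupType) (A : set G) n g :
  exp_set A n g <->
  exists s : seq G, [/\ {in s, forall x, A x}, size s = n & g = \prod_(x <- s) x].
Proof.
split=> [[f fA <-]|[s [sA <- ->]]].
  exists [seq f i | i <- index_enum 'I_n]; split; last by rewrite big_map.
    by move=> _ /mapP[i _ ->]; exact: fA.
  by rewrite size_map [index_enum _]unlock -enumT size_enum_ord.
exists (fun i : 'I_(size s) => nth 1 s i); first by move=> i; exact/sA/mem_nth.
by rewrite (big_nth 1) big_mkord.
Qed.

Lemma exp_setD (G : groupType) (A : set G) m n g h :
  exp_set A m g -> exp_set A n h -> exp_set A (m + n) (g * h).
Proof.
move=> /exp_setP[s [sA <- ->]] /exp_setP[r [rA <- ->]]; apply/exp_setP.
exists (s ++ r); split; last by rewrite big_cat.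
  by move=> x; rewrite mem_cat => /orP[/sA|/rA].
by rewrite size_cat.
Qed.

Lemma exp_set1 (G : groupType) (A : set G) a : A a -> exp_set A 1 a.
Proof.
move=> Aa; apply/exp_setP; exists [:: a]; split=> //; last by rewrite big_seq1.
by move=> x; rewrite inE => /eqP->.
Qed.

(** Appending pairs a a^-1 turns a bound on length into an exact length, up to parity. *)
Lemma exp_set_pad (G : groupType) (A : set G) a m k g :
  A a -> A a^-1 -> exp_set A m g -> exp_set A (m + k.*2) g.
Proof.
move=> Aa AV Ag; elim: k => [|k IH]; first by rewrite addn0.
rewrite doubleS -addn2 addnA -[g]mulg1 -(mulgV a).
by apply: exp_setD IH _; exact: (exp_setD (exp_set1 Aa) (exp_set1 AV)).
Qed.

Lemma exp_set_gen (G : groupType) (A : set G) n :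
  exp_set A n `<=` gen_set A.
Proof.
move=> _ /exp_setP[s [sA _ ->]]; have sg := subgroup_gen A.
elim: s sA => [|x s IH] sA; first by rewrite big_nil; exact: subgroup1.
rewrite big_cons; apply: (subgroupM sg).
  by apply: sub_gen_smallest; apply: sA; exact: mem_head.
by apply: IH => y sy; apply: sA; rewrite inE sy orbT.
Qed.

Lemma card_seq_le (T : eqType) (s : seq T) n :
  (size s <= n)%N -> [set` s] #<= `I_n.
Proof.
case: s => [|x s] sn.
  by rewrite (_ : [set` [::]] = set0) ?card_ge0 //; apply/seteqP; split.
apply: card_le_trans (card_image_le (nth x (x :: s)) `I_n).
apply: subset_card_le => y /= ys; exists (index y (x :: s)); last exact: nth_index.
by apply: leq_trans sn; rewrite index_mem.
Qed.

Theorem theorem1p3 (G : groupType) (vnilG : virtually_nilpotent G)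
    (A : set G) (finA : finite_set A) (A_neq0 : A !=set0)
    (symA : inv_set A = A) :
  (forall r : nat, (0 < r)%N ->
     exists l h0 : nat, [/\ (0 < l)%N, (0 < h0)%N &
       forall h : nat, (h0 <= h)%N ->
         exists X : set G,
           [/\ X `<=` gen_set A, X #<= `I_l &
               exp_set A (r * h)%N `<=` mul_set X (exp_set A h)]])
  /\ asymptotic_approximate_group A.
Proof.
set P := forall r, _.
suff HP : P.
  split=> // r /HP[l [h0 [l0 h00 hX]]]; exists l; split=> //; split=> //.
  by exists h0; split=> // h /hX[X [_ sX AX]]; exists X.
have AV a : A a -> A a^-1 by move=> Aa; rewrite -symA; exists a.
have [a Aa] := A_neq0; have [sA sAE] := (finite_seqP A).1 finA.
have sAP x : (x \in sA) <-> A x by rewrite sAE.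
have [|M hM] := @ball_cover G sA vnilG; first by move=> x /sAP/AV/sAP.
(* M < 2^e, so radius M 2^k is below 2^(e+k) <= h, while h < 2^(e+k+1) gives the radius r 2^(e+1)
   2^k for the set to be covered. *)
move=> r r0; pose e := M.+1.
have [l hl] := hM (r * 2 ^ e.+1)%N.
(* The factor 2 allows for both parities, the successor keeps the bound positive, and h >= 2^e makes
   the subtraction in [k] exact. *)
exists (l.+1 * 2)%N, (2 ^ e)%N; split; rewrite ?expn_gt0 // => h leh.
have h0 : (0 < h)%N by rewrite (leq_trans _ leh) ?expn_gt0.
have /andP[loh hih] := trunc_log_bounds (ltnSn 1) h0.
pose k := (trunc_log 2 h - e)%N.
have Ek : trunc_log 2 h = (e + k)%N by rewrite subnKC // trunc_log_max.
rewrite {}Ek in loh hih.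
have [X [sX hX]] := hl k.
pose Y := [seq x * b | x <- X, b <- [:: 1; a]].
(* The covering does not place its translates in the subgroup generated by [A]; those actually used
   are there, being of the form g v^-1. *)
exists ([set` Y] `&` gen_set A); split; first by move=> ? [].
  have YA : [set` Y] `&` gen_set A `<=` [set` Y] by move=> ? [].
  apply: card_le_trans (subset_card_le YA) (card_seq_le _).
  by rewrite size_allpairs leq_mul2r (leq_trans sX).
move=> g Ag; have sg := subgroup_gen A.
have Bg : ball sA (r * 2 ^ e.+1 * 2 ^ k) g.
  have /exp_setP[s [hs ss ->]] := Ag; exists s; split=> // [x /hs/sAP//|].
  by rewrite ss -mulnA leq_mul2l -expnD addSn (ltnW hih) orbT.
have [x [b [Xx [s [sS ss Eb]] Eg]]] := hX g Bg.
have Ab : exp_set A (size s) b.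
  by apply/exp_setP; exists s; split=> // y /sS/sAP.
have lts : (size s < h)%N.
  rewrite (leq_ltn_trans ss) // (leq_trans _ loh) // expnD ltn_pmul2r ?expn_gt0 //.
  by rewrite (ltn_trans _ (ltn_expl _ _)).
have key u v : u \in [:: 1; a] -> exp_set A h v -> g = x * u * v ->
    mul_set ([set` Y] `&` gen_set A) (exp_set A h) g.
  move=> uin hv gE; exists (x * u); last by exists v.
  split; first by rewrite /=; exact: allpairs_f.
  have -> : x * u = g * v^-1 by rewrite gE mulgK.
  exact: (subgroupM sg (exp_set_gen Ag) (subgroupV sg (exp_set_gen hv))).
have [odd_hs|even_hs] := boolP (odd (h - size s)); last first.
  apply: (key 1 b); [by rewrite mem_head | | by rewrite mulg1].
  have := exp_set_pad (h - size s)./2 Aa (AV _ Aa) Ab.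
  by rewrite even_halfK ?subnKC // ltnW.
(* Writing x b = (x a)(a^-1 b) adds one letter to the second factor, which corrects the parity. *)
apply: (key a (a^-1 * b)); first by rewrite !inE eqxx orbT.
  have := exp_set_pad (h - size s)./2 Aa (AV _ Aa) (exp_setD (exp_set1 (AV _ Aa)) Ab).
  by rewrite addnAC odd_halfK // -subn1 subnKC ?subn_gt0 // addnC subnKC // ltnW.
by rewrite Eg !mulgA mulgK.
Qed.
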